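(* The unitization $A^1$ of a real Jordan operator algebra $A$ is unique up to isometric Jordan isomorphism: if $B_1$ and $B_2$ are two unitizations of $A$, then there is a unital isometric Jordan isomorphism from $B_1$ onto $B_2$ restricting to the identity on $A$. In addition, $(A^1)_c = (A_c)^1$ isometrically isomorphically: the Jordan operator algebra complexification of the unitization of $A$ is isometrically Jordan isomorphic to the unitization of the Jordan operator algebra complexification $A_c$.
   Context: A real (resp. complex) Jordan operator algebra is a norm-closed real (resp. complex) subspace $A$ of a real (resp. complex) $C^*$-algebra (e.g. $B(H)$) with $a^2\in A$ for all $a \in A$; it is not assumed selfadjoint. A Jordan homomorphism is a linear map $T$ (over the relevant scalar field) with $T(a^2)=T(a)^2$. A unitization of a real Jordan operator algebra $A$ is a real Jordan operator algebra $B$ with an identity $1_B$ of norm $1$, containing $A$ isometrically as a closed Jordan subalgebra, with $1_B \notin A$ and $B = A + \mathbb{R} 1_B$; analogously, with $\mathbb{C}$ in place of $\mathbb{R}$, for complex Jordan operator algebras. For a real Hilbert space $H$ let $H_c$ be its complexification and identify $B(H)_c = B(H)+iB(H)$ with $B(H_c)$. If $A^1$ is represented as a real Jordan subalgebra $A+\mathbb{R}I_H$ of $B(H)$, then $A_c = A+iA\subseteq B(H_c)$ and $(A^1)_c = A^1+iA^1\subseteq B(H_c)$ denote the corresponding Jordan operator algebra complexifications. *)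

(* Defs.v *)
From HB Require Import structures.
From mathcomp Require Import all_boot all_order all_algebra
  sesquilinear complex.
From mathcomp Require Import ring lra.
From mathcomp Require Import all_classical all_reals all_analysis.

Set Implicit Arguments.
Unset Strict Implicit.
Unset Printing Implicit Defensive.

Import Order.TTheory GRing.Theory Num.Theory numFieldNormedType.Exports.

Local Open Scope classical_set_scope.
Local Open Scope ring_scope.

(* Real and complex Hilbert spaces are treated together: [K] is R or C and
   [conj] its conjugation (the identity for R). The inner product is linear in
   its first argument. *)
Record hilbertSpace (K : numFieldType) (conj : K -> K) := HilbertSpace {
  hilbert_carrier :> completeNormedModType K;
  inner : {dot hilbert_carrier for conj};
  innerE : forall x, `|x| ^+ 2 = inner x x }.

Notation realHilbertSpace R := (@hilbertSpace R idfun).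
Notation complexHilbertSpace R := (@hilbertSpace R[i] Num.conj).

Section Operators.
Variables (K : numFieldType) (conj : K -> K) (H : hilbertSpace conj).
Implicit Types (a b e f g : H -> H) (A B C : set (H -> H)).

Definition bounded_operator f :=
  linear f /\ exists M, forall x, `|f x| <= M * `|x|.

Definition is_adjoint f g := forall x y, inner H (f x) y = inner H x (g y).

(* Norms take their values in [K]; when [K] is the field of complex numbers
   this is a supremum for its partial order, in which the upper bounds of a
   nonempty set of nonnegative numbers are real. *)
Definition opnorm f : K :=
  supremum 0 [set `|f x| | x in [set x : H | `|x| <= 1]].

Definition subspace_op A :=
  A 0 /\ forall (c : K) a b, A a -> A b -> A (c *: a + b).

Definition norm_closed A :=
  forall f, bounded_operator f ->
    (forall eps : K, 0 < eps -> exists2 a, A a & opnorm (f - a) < eps) -> A f.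

(* Real and complex C*-algebras, concretely: norm-closed *-subalgebras of
   B(H) for a real, resp. complex, Hilbert space H. *)
Definition Cstar_algebra C :=
  [/\ C `<=` bounded_operator, subspace_op C, norm_closed C,
      (forall a b, C a -> C b -> C (a \o b))
    & (forall a, C a -> exists2 b, C b & is_adjoint a b)].

Definition jordan_operator_algebra A :=
  exists C, [/\ Cstar_algebra C, A `<=` C, subspace_op A, norm_closed A
              & forall a, A a -> A (a \o a)].

Definition jordan_product a b := (2 : K)^-1 *: (a \o b + b \o a).

Definition jordan_identity B e :=
  B e /\ forall b, B b -> jordan_product e b = b.

End Operators.

Section Morphisms.
Variables (K : numFieldType) (conj : K -> K) (H L : hilbertSpace conj).
Implicit Types (A : set (H -> H)) (B : set (L -> L)).
Implicit Types (T : (H -> H) -> L -> L).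

(* Maps between spaces of operators are given by functions on all of
   [H -> H], of which only the values on [A] matter. *)
Definition jordan_hom A B T :=
  [/\ (forall a, A a -> B (T a)),
      (forall (c : K) a b, A a -> A b -> T (c *: a + b) = c *: T a + T b)
    & (forall a, A a -> T (a \o a) = T a \o T a)].

Definition isometric_jordan_hom A B T :=
  jordan_hom A B T /\ forall a, A a -> opnorm (T a) = opnorm a.

(* Injectivity need not be required: an isometric linear map is injective. *)
Definition isometric_jordan_iso A B T :=
  isometric_jordan_hom A B T /\ T @` A = B.

(* [B], with identity [e], is a unitization of [A]; the inclusion of [A] in
   [B] is the isometric Jordan homomorphism [i]. *)
Definition unitization A B (e : L -> L) (i : (H -> H) -> L -> L) :=
  [/\ jordan_operator_algebra B,
      jordan_identity B e /\ opnorm e = 1,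
      isometric_jordan_hom A B i /\ norm_closed (i @` A),
      ~ (i @` A) e
    & B = [set b | exists2 a, A a & exists c : K, b = i a + c *: e]].

End Morphisms.

(* [(x, y)] stands for [x + iy]. *)
Definition complexification (R : realType) (H : realHilbertSpace R) : Type :=
  (H * H)%type.

Section Complexification.
Variables (R : realType) (H : realHilbertSpace R).
Local Notation Hc := (complexification H).
Implicit Types (z w : Hc).

HB.instance Definition _ := GRing.Zmodule.copy Hc (H * H)%type.

Definition complexification_scale (c : R[i]) z : Hc :=
  (complex.Re c *: z.1 - complex.Im c *: z.2,
   complex.Im c *: z.1 + complex.Re c *: z.2).

Definition complexification_norm z : R[i] :=
  (Num.sqrt (`|z.1| ^+ 2 + `|z.2| ^+ 2))%:C%C.

Definition complexification_inner z w : R[i] :=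
  ((inner H z.1 w.1 + inner H z.2 w.2)
   +i* (inner H z.2 w.1 - inner H z.1 w.2))%C.

Let addHcE z w : z + w = (z.1 + w.1, z.2 + w.2). Proof. by []. Qed.

Let scaleA a b z : complexification_scale a (complexification_scale b z) =
  complexification_scale (a * b) z.
Proof.
case: a b z => [a1 a2] [b1 b2] [x y]; rewrite /complexification_scale /=.
congr (_, _); rewrite !(scalerBr, scalerBl, scalerDr, scalerDl, scalerA).
  by rewrite !opprD addrACA.
by rewrite addrC addrACA.
Qed.

Let scale1 : left_id 1 complexification_scale.
Proof.
by case=> x y; rewrite /complexification_scale /= !scale1r !scale0r subr0 add0r.
Qed.

Let scaleDr : right_distributive complexification_scale +%R.
Proof.
move=> [a b] [x y] [x' y']; rewrite /complexification_scale !addHcE /=.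
by rewrite !scalerDr opprD; congr (_, _); rewrite addrACA.
Qed.

Let scaleDl v : {morph complexification_scale^~ v : a b / a + b}.
Proof.
case: v => x y [a b] [a' b']; rewrite /complexification_scale !addHcE /=.
by rewrite !scalerDl opprD; congr (_, _); rewrite addrACA.
Qed.

HB.instance Definition _ := GRing.Zmodule_isLmodule.Build R[i] Hc
  scaleA scale1 scaleDr scaleDl.

Let innerB (x x' y : H) : inner H (x - x') y = inner H x y - inner H x' y.
Proof. exact: (@zmod_morphisml_subproof _ _ _ _ _ _ (inner H) y x x'). Qed.

Let innerN (x y : H) : inner H (- x) y = - inner H x y.
Proof.
have inner0 : inner H 0 y = 0 by rewrite -[X in inner H X](subrr 0) innerB subrr.
by rewrite -sub0r innerB inner0 sub0r.
Qed.

Let innerD (x x' y : H) : inner H (x + x') y = inner H x y + inner H x' y.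
Proof. by rewrite -[x']opprK innerB (innerN (- x')). Qed.

Let innerZ (a : R) (x y : H) : inner H (a *: x) y = a * inner H x y.
Proof. exact: (@linearl_subproof _ _ _ _ _ _ (inner H) y a x). Qed.

Let innerC (x y : H) : inner H x y = inner H y x.
Proof. by rewrite hermitian_subproof expr0 mul1r. Qed.

Let normE (x : H) : `|x| ^+ 2 = inner H x x. Proof. exact: innerE. Qed.


Let normD z w : complexification_norm (z + w) <=
  complexification_norm z + complexification_norm w.
Proof.
have normcE (v : Hc) : complexification_norm v = `|(`|v.1| +i* `|v.2|)%C|.
  by rewrite normc_def.
rewrite [X in _ <= X + _]normcE [X in _ <= _ + X]normcE.
apply: le_trans (ler_normD _ _); rewrite normcE addHcE !normc_def /= lecE eqxx /=.
by rewrite ler_wsqrtr // lerD // lerXn2r ?nnegrE ?addr_ge0 // ler_normD.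
Qed.

Let normZ (c : R[i]) z :
  complexification_norm (c *: z) = `|c| * complexification_norm z.
Proof.
case: c z => [a b] [x y]; rewrite /complexification_norm normc_def /= -rmorphM.
rewrite -sqrtrM ?addr_ge0 ?sqr_ge0 //; congr (Num.sqrt _)%:C%C.
rewrite !normE !(innerB, innerD, innerZ).
rewrite ![inner H _ (_ - _)]innerC ![inner H _ (_ + _)]innerC.
rewrite !(innerB, innerD, innerZ) (innerC y x); ring.
Qed.

Let norm_eq0 z : complexification_norm z = 0 -> z = 0.
Proof.
case: z => x y [] /eqP; rewrite sqrtr_eq0 => xy0.
have x0 : `|x| ^+ 2 <= 0 by apply: le_trans xy0; rewrite lerDl sqr_ge0.
have y0 : `|y| ^+ 2 <= 0 by apply: le_trans xy0; rewrite lerDr sqr_ge0.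
move: x0 y0; rewrite !exprn_even_le0 //= !normr_eq0 => /eqP -> /eqP ->.
by [].
Qed.

HB.instance Definition _ := @Lmodule_isNormed.Build R[i] Hc
  complexification_norm normD normZ norm_eq0.

Let normHcE z : `|z| = (Num.sqrt (`|z.1| ^+ 2 + `|z.2| ^+ 2))%:C%C.
Proof. by []. Qed.

Let norm_fst z e : `|z| < e%:C%C -> `|z.1| < e.
Proof.
rewrite normHcE ltcR; apply: le_lt_trans.
by rewrite -[leLHS]ger0_norm // -sqrtr_sqr ler_wsqrtr // lerDl sqr_ge0.
Qed.

Let norm_snd z e : `|z| < e%:C%C -> `|z.2| < e.
Proof.
rewrite normHcE ltcR; apply: le_lt_trans.
by rewrite -[leLHS]ger0_norm // -sqrtr_sqr ler_wsqrtr // lerDr sqr_ge0.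
Qed.

Let Hc_complete (F : set_system Hc) : ProperFilter F -> cauchy F -> cvg F.
Proof.
move=> FF /cauchyP Fc.
have cvg1 : cvg (fst @ F : set_system H).
  apply/cauchy_cvgP/cauchyP => e e0.
  have /Fc[z zF] : 0 < e%:C%C by rewrite ltcR.
  exists z.1; rewrite /fmap /=; apply: (@filterS _ F _ _ _ _ zF) => w.
  rewrite /= -!ball_normE /=; exact: (@norm_fst (z - w)).
have cvg2 : cvg (snd @ F : set_system H).
  apply/cauchy_cvgP/cauchyP => e e0.
  have /Fc[z zF] : 0 < e%:C%C by rewrite ltcR.
  exists z.2; rewrite /fmap /=; apply: (@filterS _ F _ _ _ _ zF) => w.
  rewrite /= -!ball_normE /=; exact: (@norm_snd (z - w)).
apply/cvg_ex; exists (lim (fst @ F : set_system H), lim (snd @ F : set_system H)).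
apply/cvgrPdist_lt => -[e i]; rewrite ltcE /= => /andP[/eqP -> e0].
have e20 : 0 < e / 2 by rewrite divr_gt0.
near=> z.
rewrite normHcE ltcR /=.
set l1 := lim _; set l2 := lim _.
have h1 : `|l1 - z.1| < e / 2.
  by near: z; exact: ((cvgrPdist_lt _ _).1 cvg1).
have h2 : `|l2 - z.2| < e / 2.
  by near: z; exact: ((cvgrPdist_lt _ _).1 cvg2).
rewrite -[ltRHS]ger0_norm ?ltW // -sqrtr_sqr ltr_sqrt ?exprn_gt0 //.
have := normr_ge0 (l1 - z.1); have := normr_ge0 (l2 - z.2).
move: h1 h2; nra.
Unshelve. all: by end_near. Qed.

HB.instance Definition _ := Uniform_isComplete.Build Hc Hc_complete.

Let inner_bilinear :
  bilinear_for *%R (Num.conj \; *%R) complexification_inner.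
Proof.
split=> [w [a b] u v|u [a b] v w]; rewrite /complexification_inner;
  case: u v w => [u1 u2] [v1 v2] [w1 w2] /=.
  apply/eqP; rewrite eq_complex /=.
  rewrite !(innerB, innerD, innerZ); apply/andP; split; apply/eqP; ring.
apply/eqP; rewrite eq_complex /=.
rewrite ![inner H _ (_ + _)]innerC !(innerB, innerD, innerZ).
rewrite ![inner H _ u1]innerC ![inner H _ u2]innerC.
apply/andP; split; apply/eqP; ring.
Qed.

HB.instance Definition _ := @bilinear_isBilinear.Build R[i] Hc Hc R[i] _ _
  complexification_inner inner_bilinear.

Let inner_hermitian z w : complexification_inner z w =
  (-1) ^+ false * Num.conj (complexification_inner w z).
Proof.
rewrite expr0 mul1r /complexification_inner; apply/eqP.
rewrite eq_complex /= opprB ![inner H w.1 _]innerC ![inner H w.2 _]innerC.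
by rewrite !eqxx.
Qed.

HB.instance Definition _ := @isHermitianSesquilinear.Build R[i] Hc false Num.conj
  complexification_inner inner_hermitian.

Let inner_norm z : `|z| ^+ 2 = complexification_inner z z.
Proof.
rewrite normHcE -rmorphXn /= sqr_sqrtr // /complexification_inner !normE.
by rewrite [inner H z.2 z.1]innerC subrr.
Qed.

Let inner_gt0 z : z != 0 -> 0 < complexification_inner z z.
Proof. by move=> z0; rewrite -inner_norm exprn_gt0 // normr_gt0. Qed.

HB.instance Definition _ := @isDotProduct.Build R[i] Hc complexification_inner
  inner_gt0.

Definition hilbert_complexification : complexHilbertSpace R :=
  @HilbertSpace R[i] Num.conj Hc complexification_inner inner_norm.

End Complexification.

Section ComplexifiedOperators.
Variables (R : realType) (H : realHilbertSpace R).
Local Notation Hc := (hilbert_complexification H).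

(* [a + ib], for [a] and [b] operators on [H], as an operator on [Hc]. *)
Definition complex_operator (a b : H -> H) : Hc -> Hc :=
  fun z => (a z.1 - b z.2, b z.1 + a z.2).

(* [A + iA] *)
Definition complexified_operators (A : set (H -> H)) : set (Hc -> Hc) :=
  [set f | exists2 a, A a & exists2 b, A b & f = complex_operator a b].

End ComplexifiedOperators.

(* Main.v *)
(* Let [a] be an operator in a Jordan algebra without unit and [T = a + l], where
   [|T| <= 1] and [|l| < 1]. The Moebius transform [(T - l) (1 - conj l T)^-1] is
   a contraction iff [T] is, and it lies in the closed Jordan algebra generated
   by [a], being the sum of [(conj l T)^k a]. Hence the norm of [T] is determined
   by the norms of elements of the algebra without unit (Meyer's theorem), and
   [i1 a + l e1 |-> i2 a + l e2] is an isometry between any two unitizations.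
   The proof uses the partial sums of the series only, and applies verbatim to
   real and complex scalars; so the second claim reduces to the fact that
   [A1 + i A1] is a unitization of [A + i A]. *)

Require Import Defs.
From mathcomp Require Import all_boot all_order all_algebra sesquilinear complex.
From mathcomp Require Import ring lra.
From mathcomp Require Import all_classical all_reals all_analysis.

Set Implicit Arguments.
Unset Strict Implicit.
Unset Printing Implicit Defensive.

Import Order.TTheory GRing.Theory Num.Theory numFieldNormedType.Exports.

Local Open Scope classical_set_scope.
Local Open Scope ring_scope.

Definition scalar_embedding (R : realType) (K : numFieldType)
    (rho : {rmorphism R -> K}) :=
  {mono rho : x y / x <= y} /\ forall z, 0 <= z -> exists x, z = rho x.

Section Scalars.
Variables (R : realType) (K : numFieldType) (rho : {rmorphism R -> K}).
Hypothesis rhoP : scalar_embedding rho.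

Lemma embedding_le : {mono rho : x y / x <= y}. Proof. by case: rhoP. Qed.

Lemma embedding_lt : {mono rho : x y / x < y}.
Proof. exact: leW_mono embedding_le. Qed.

Lemma embedding_ge0 x : (0 <= rho x) = (0 <= x).
Proof. by rewrite -{1}(rmorph0 rho) embedding_le. Qed.

Lemma embedding_surj z : 0 <= z -> exists x, z = rho x.
Proof. by case: rhoP => _; exact. Qed.

Lemma supremum_nneg (S : set K) : S !=set0 -> (forall x, S x -> 0 <= x) ->
  ubound S !=set0 -> supremums S (supremum 0 S).
Proof.
move=> [s0 Ss0] S0 [M MS].
have M0 : 0 <= M := le_trans (S0 _ Ss0) (MS _ Ss0).
have [m Mm] := embedding_surj M0.
have [x0 s0x0] := embedding_surj (S0 _ Ss0).
pose S' := [set x | S (rho x)].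
have S'sup : has_sup S'.
  split; first by exists x0; rewrite /S' /= -s0x0.
  by exists m => x /MS; rewrite Mm embedding_le.
rewrite /supremum ifF; last by apply/eqP => SE; rewrite SE in Ss0.
apply: xgetPex; exists (rho (sup S')); split=> [x Sx|u Su].
  have [y xy] := embedding_surj (S0 _ Sx).
  rewrite xy embedding_le; apply: sup_upper_bound => //.
  by rewrite /S' /= -xy.
have u0 : 0 <= u := le_trans (S0 _ Ss0) (Su _ Ss0).
have [v uv] := embedding_surj u0.
rewrite uv embedding_le; apply: ge_sup; first by case: S'sup.
by move=> x /Su; rewrite uv embedding_le.
Qed.

Lemma geometric_small (r eps : K) : 0 <= r -> r < 1 -> 0 < eps ->
  exists n, r ^+ n < eps.
Proof.
move=> r0 r1 eps0; have [s rs] := embedding_surj r0.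
have [d ed] := embedding_surj (ltW eps0).
have s0 : 0 <= s by rewrite -embedding_ge0 -rs.
have s1 : `|s| < 1 by rewrite ger0_norm // -embedding_lt -rs rmorph1.
have d0 : 0 < d by rewrite -embedding_lt rmorph0 -ed.
have /cvgrPdist_lt/(_ _ d0)[n _ /(_ n (leqnn n))] := cvg_expr s1.
rewrite /= sub0r normrN ger0_norm ?exprn_ge0 // => snd.
by exists n; rewrite rs ed -rmorphXn embedding_lt.
Qed.

Lemma le_geometric_limit (r u v w : K) : 0 <= r -> r < 1 -> 0 <= v -> 0 <= w ->
  (forall n, u <= (1 + r ^+ n) * v + r ^+ n * w) -> u <= v.
Proof.
move=> r0 r1 v0 w0 uvw; apply/ler_addgt0Pr => eps eps0.
have c0 : 0 < v + w + 1 by rewrite ltr_wpDl // addr_ge0.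
have [n rn] := geometric_small r0 r1 (divr_gt0 eps0 c0).
apply: le_trans (uvw n) _; rewrite mulrDl mul1r -addrA lerD2l -mulrDr.
have : r ^+ n * (v + w) <= r ^+ n * (v + w + 1).
  by rewrite ler_wpM2l ?exprn_ge0 // lerDl.
by move/le_trans; apply; rewrite -ler_pdivlMr // ltW.
Qed.

Section OperatorNorm.
Variables (conj : K -> K) (H : hilbertSpace conj).
Implicit Types f g : H -> H.

Lemma opnorm_supremums f M : (forall x, `|f x| <= M * `|x|) ->
  supremums [set `|f x| | x in [set x : H | `|x| <= 1]] (opnorm f).
Proof.
move=> fM; apply: supremum_nneg.
- by exists `|f 0|, 0; rewrite //= normr0 ler01.
- by move=> _ [x _ <-].
exists `|M| => _ [x /= x1 <-]; apply: le_trans (_ : `|M * `|x| | <= _).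
  by rewrite ger0_norm // (le_trans _ (fM x)).
by rewrite normrM normr_id ler_piMr.
Qed.

Lemma opnorm_ge0 f : bounded_operator f -> 0 <= opnorm f.
Proof.
move=> [_ [M fM]]; have [+ _] := opnorm_supremums fM.
move/(_ `|f 0|) => f0; apply: le_trans (f0 _) => //.
by exists 0; rewrite //= normr0 ler01.
Qed.

Lemma opnorm_le f M : 0 <= M -> (forall x, `|f x| <= M * `|x|) -> opnorm f <= M.
Proof.
move=> M0 fM; have [_] := opnorm_supremums fM; apply=> _ [x /= x1 <-].
by apply: le_trans (fM x) _; rewrite ler_piMr.
Qed.

Lemma opnorm_bound f : bounded_operator f ->
  forall x, `|f x| <= opnorm f * `|x|.
Proof.
move=> bf x; case: (bf) => flin [M fM].
have fZ c y : f (c *: y) = c *: f y.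
  have f0 : f 0 = 0.
    by have := flin (-1) 0 0; rewrite scaler0 addr0 scaleN1r addNr.
  by have := flin c y 0; rewrite f0 !addr0.
have [->|x0] := eqVneq x 0.
  by rewrite -(scale0r (0 : H)) fZ !scale0r normr0 mulr0.
have nx0 : `|x| \is a GRing.unit by rewrite unitfE normr_eq0.
have [+ _] := opnorm_supremums fM.
move/(_ `|f (`|x|^-1 *: x)|); rewrite fZ normrZ normfV normr_id mulrC.
rewrite ler_pdivrMr ?normr_gt0 //; apply; exists (`|x|^-1 *: x).
  by rewrite /= normrZ normfV normr_id mulVr.
by rewrite fZ normrZ normfV normr_id mulrC.
Qed.

Lemma opnorm_eq0 f : bounded_operator f -> opnorm f = 0 -> f = 0.
Proof.
move=> bf f0; apply/funext => x; apply/eqP; rewrite -normr_le0.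
by have := opnorm_bound bf x; rewrite f0 mul0r.
Qed.

End OperatorNorm.
End Scalars.

Section LinearOperators.
Variables (K : numFieldType) (conj : K -> K) (H : hilbertSpace conj).
Implicit Types (f g : H -> H) (c : K).

Lemma boundedP f c x y : bounded_operator f -> f (c *: x + y) = c *: f x + f y.
Proof. by case=> flin _; exact: flin. Qed.

Lemma boundedB f x y : bounded_operator f -> f (x - y) = f x - f y.
Proof.
by move=> bf; have := boundedP (-1) y x bf; rewrite !scaleN1r ![- _ + _]addrC.
Qed.

Lemma bounded0 f : bounded_operator f -> f 0 = 0.
Proof. by move=> bf; rewrite -[X in f X](subrr 0) boundedB // subrr. Qed.

Lemma boundedZ f c x : bounded_operator f -> f (c *: x) = c *: f x.
Proof. by move=> bf; rewrite -[c *: x]addr0 boundedP // bounded0 // addr0. Qed.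

Lemma boundedD f x y : bounded_operator f -> f (x + y) = f x + f y.
Proof. by move=> bf; rewrite -[x in LHS]scale1r boundedP // scale1r. Qed.

Lemma bounded_nneg f : bounded_operator f ->
  exists2 M, 0 <= M & forall x, `|f x| <= M * `|x|.
Proof.
move=> [_ [M fM]]; exists `|M| => // x.
have <- : `|M * `|x| | = `|M| * `|x| by rewrite normrM normr_id.
by rewrite ger0_norm // (le_trans _ (fM x)).
Qed.

Lemma bounded_operatorD c f g : bounded_operator f -> bounded_operator g ->
  bounded_operator (c *: f + g).
Proof.
move=> bf bg; split=> [d x y|].
  rewrite !fctE !(boundedP _ _ _ bf) !(boundedP _ _ _ bg) !scalerDr !scalerA.
  by rewrite [c * d]mulrC addrACA.
have [M _ fM] := bounded_nneg bf; have [N _ gN] := bounded_nneg bg.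
exists (`|c| * M + N) => x; rewrite !fctE (le_trans (ler_normD _ _)) //.
by rewrite normrZ mulrDl lerD // -mulrA ler_wpM2l.
Qed.

Lemma bounded_operator0 : bounded_operator (0 : H -> H).
Proof.
rewrite (_ : 0 = fun=> 0) //; split=> [d x y|].
  by rewrite scaler0 addr0.
by exists 0 => x; rewrite normr0 mul0r.
Qed.

Lemma iter_boundedZ f n c x : bounded_operator f ->
  iter n f (c *: x) = c *: iter n f x.
Proof. by move=> bf; elim: n => //= n ->; rewrite boundedZ. Qed.

Lemma iter_boundedB f n x y : bounded_operator f ->
  iter n f (x - y) = iter n f x - iter n f y.
Proof. by move=> bf; elim: n => //= n ->; rewrite boundedB. Qed.

Lemma iter_contraction f n x : (forall x, `|f x| <= `|x|) ->
  `|iter n f x| <= `|x|.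
Proof. by move=> f1; elim: n => //= n; exact: le_trans (f1 _). Qed.

Definition geometric_sum c f n x := \sum_(k < n) c ^+ k *: iter k f x.

Lemma geometric_sumS c f n x :
  geometric_sum c f n.+1 x = geometric_sum c f n x + c ^+ n *: iter n f x.
Proof. by rewrite /geometric_sum big_ord_recr. Qed.

Lemma geometric_sum_telescope c f n x : bounded_operator f ->
  geometric_sum c f n (x - c *: f x) = x - c ^+ n *: iter n f x.
Proof.
move=> bf; elim: n => [|n IHn].
  by rewrite /geometric_sum big_ord0 scale1r subrr.
rewrite geometric_sumS {}IHn iter_boundedB // iter_boundedZ // scalerBr scalerA.
by rewrite -exprSr -iterSr addrA subrK.
Qed.

Lemma geometric_sum_comm c f g n x : bounded_operator g ->
    (forall x, f (g x) = g (f x)) ->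
  geometric_sum c f n (g x) = g (geometric_sum c f n x).
Proof.
move=> bg fg; elim: n => [|n IHn].
  by rewrite /geometric_sum !big_ord0 bounded0.
rewrite !geometric_sumS IHn (boundedD _ _ bg) (boundedZ _ _ bg); congr (_ + _ *: _).
by elim: n {IHn} => //= n ->.
Qed.

Lemma geometric_sumZ c f n d x : bounded_operator f ->
  geometric_sum c f n (d *: x) = d *: geometric_sum c f n x.
Proof.
move=> bf; rewrite /geometric_sum scaler_sumr; apply: eq_bigr => k _.
by rewrite iter_boundedZ // !scalerA mulrC.
Qed.

Lemma geometric_sumB c f n x y : bounded_operator f ->
  geometric_sum c f n (x - y) = geometric_sum c f n x - geometric_sum c f n y.
Proof.
move=> bf; rewrite /geometric_sum -sumrB; apply: eq_bigr => k _.
by rewrite iter_boundedB // scalerBr.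
Qed.

End LinearOperators.

Section JordanAlgebra.
Variables (K : numFieldType) (conj : K -> K) (H : hilbertSpace conj).
Variable A : set (H -> H).
Implicit Types (a b e : H -> H) (c : K).
Hypothesis hA : jordan_operator_algebra A.

Lemma jordan_algebra_bounded a : A a -> bounded_operator a.
Proof. by case: hA => C [[Cb _ _ _ _] AC _ _ _] /AC/Cb. Qed.

Lemma jordan_algebra_linear c a b : A a -> A b -> A (c *: a + b).
Proof. by case: hA => C [_ _ [_ Alin] _ _]; exact: Alin. Qed.

Lemma jordan_algebra0 : A 0.
Proof. by case: hA => C [_ _ [A0 _] _ _]. Qed.

Lemma jordan_algebraD a b : A a -> A b -> A (a + b).
Proof. by move=> Aa Ab; rewrite -[a]scale1r; exact: jordan_algebra_linear. Qed.

Lemma jordan_algebraZ c a : A a -> A (c *: a).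
Proof.
move=> Aa; rewrite -[c *: a]addr0; apply: jordan_algebra_linear => //.
exact: jordan_algebra0.
Qed.

Lemma jordan_algebraB a b : A a -> A b -> A (a - b).
Proof.
by move=> Aa Ab; rewrite addrC -scaleN1r; exact: jordan_algebra_linear.
Qed.

Lemma jordan_algebra_sqr a : A a -> A (a \o a).
Proof. by case: hA => C [_ _ _ _]; exact. Qed.

Definition anticommutator a b : H -> H := (a \o b) + (b \o a).

Lemma anticommutatorE a b : bounded_operator a -> bounded_operator b ->
  anticommutator a b =
    ((a + b) \o (a + b)) - (a \o a) - (b \o b).
Proof.
move=> ba bb; apply/funext => x; rewrite /anticommutator !fctE.
rewrite !(boundedD _ _ ba) !(boundedD _ _ bb).
by rewrite -[_ + _ + (_ + _)]addrA [a (a x) + _]addrC addrK addrA addrK.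
Qed.

Lemma jordan_algebra_anticommutator a b : A a -> A b -> A (anticommutator a b).
Proof.
move=> Aa Ab; rewrite anticommutatorE; last 2 first.
- exact: jordan_algebra_bounded.
- exact: jordan_algebra_bounded.
apply: jordan_algebraB; last exact: jordan_algebra_sqr.
apply: jordan_algebraB; last exact: jordan_algebra_sqr.
by apply: jordan_algebra_sqr; exact: jordan_algebraD.
Qed.

(* As [\o] and [+] have the same precedence, [jordan_product e b] reads
   [2^-1 *: ((e \o b + b) \o e)]. For [b = e] the identity axiom then gives
   [e (e - 1) (e + 2) = 0], where [e + 2] is injective as [e] is contractive. *)
Lemma jordan_identity_mul e b :
    jordan_identity A e -> (forall x, `|e x| <= `|x|) -> A b ->
  (forall x, e (b x) = b x) /\ (forall x, b (e x) = b x).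
Proof.
move=> [Ae eA] e1 Ab; have be := jordan_algebra_bounded Ae.
have two x y : x + x = y + y -> x = y :> H.
  move=> xy; have: (2 : K) *: x = 2 *: y by rewrite !scaler_nat !mulr2n.
  by apply: scalerI; rewrite pnatr_eq0.
have eb2 d (Ad : A d) x : e (d (e x)) + d (e x) = d x + d x.
  have := congr1 (fun f : H -> H => 2 *: f x) (eA _ Ad).
  rewrite /jordan_product !fctE scalerA divff ?pnatr_eq0 // scale1r => ->.
  by rewrite scaler_nat mulr2n.
have ee x : e (e x) = e x.
  apply/eqP; rewrite -subr_eq0; set y := _ - _.
  have ey : e y = - (y + y).
    rewrite boundedB // (_ : e (e (e x)) = e x + e x - e (e x)); last first.
      by rewrite -eb2 // addrK.
    by rewrite -addrA addrACA /y -[e (e x) - _]opprB opprD !opprK.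
  have := e1 y; rewrite ey normrN -mulr2n -scaler_nat normrZ normr_nat.
  rewrite -subr_ge0 -{1}[`|y|]mul1r -mulrBl.
  have -> : 1 - 2 = -1 :> K by ring.
  by rewrite mulN1r oppr_ge0 normr_le0.
have be1 x : b (e x) = b x by apply: two; rewrite -[RHS]eb2 // -{1}eb2 // ee.
by split=> // x; apply: (@addIr _ (b x)); rewrite -eb2 // be1.
Qed.

End JordanAlgebra.

Section JordanHomomorphisms.
Variables (K : numFieldType) (conj : K -> K) (H L : hilbertSpace conj).
Variables (A : set (H -> H)) (B : set (L -> L)) (i : (H -> H) -> L -> L).
Implicit Types (a b : H -> H) (c : K).
Hypotheses (hA : jordan_operator_algebra A) (hB : jordan_operator_algebra B).
Hypothesis hi : jordan_hom A B i.

Lemma jordan_hom_mem a : A a -> B (i a). Proof. by case: hi => + _ _; apply. Qed.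

Lemma jordan_hom_bounded a : A a -> bounded_operator (i a).
Proof. by move/jordan_hom_mem; exact: jordan_algebra_bounded. Qed.

Lemma jordan_homP c a b : A a -> A b -> i (c *: a + b) = c *: i a + i b.
Proof. by case: hi => _ + _; apply. Qed.

Lemma jordan_homD a b : A a -> A b -> i (a + b) = i a + i b.
Proof. by move=> *; rewrite -[a]scale1r jordan_homP // !scale1r. Qed.

Lemma jordan_hom0 : i 0 = 0.
Proof.
have A0 := jordan_algebra0 hA.
have := jordan_homP (-1) A0 A0.
by rewrite scaleN1r oppr0 addr0 scaleN1r addNr.
Qed.

Lemma jordan_homZ c a : A a -> i (c *: a) = c *: i a.
Proof.
move=> Aa; rewrite -[c *: a]addr0 jordan_homP ?jordan_hom0 ?addr0 //.
exact: jordan_algebra0.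
Qed.

Lemma jordan_homB a b : A a -> A b -> i (a - b) = i a - i b.
Proof. by move=> Aa Ab; rewrite addrC -scaleN1r jordan_homP // scaleN1r addrC. Qed.

Lemma jordan_hom_sqr a : A a -> i (a \o a) = i a \o i a.
Proof. by case: hi => _ _; exact. Qed.

Lemma jordan_hom_anticommutator a b : A a -> A b ->
  i (anticommutator a b) = anticommutator (i a) (i b).
Proof.
move=> Aa Ab; have Aab := jordan_algebraD hA Aa Ab.
have ba := jordan_algebra_bounded hA Aa.
have bb := jordan_algebra_bounded hA Ab.
rewrite !anticommutatorE //; try exact: jordan_hom_bounded.
have Sq d : A d -> A (d \o d) := @jordan_algebra_sqr _ _ _ _ hA d.
rewrite ?jordan_homB ?jordan_hom_sqr ?jordan_homD //;
  do ?apply: (jordan_algebraB hA); exact: Sq.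
Qed.

End JordanHomomorphisms.

Section Unitization.
Variables (R : realType) (K : numFieldType) (rho : {rmorphism R -> K}).
Hypothesis rhoP : scalar_embedding rho.
Variable conj : K -> K.
Hypotheses (conjK : involutive conj) (mul_conj : forall z, `|z| ^+ 2 = z * conj z).

(* For [t = T x] this says that [T] is a contraction iff its Moebius transform
   [(T - l) (1 - conj l T)^-1] is one. *)
Lemma mobius_identity (H : hilbertSpace conj) (l : K) (x t : H) :
  (1 - `|l| ^+ 2) * (`|x| ^+ 2 - `|t| ^+ 2) =
  `|x - conj l *: t| ^+ 2 - `|t - l *: x| ^+ 2.
Proof.
rewrite mul_conj !innerE !(linearBl (inner H)) !(linearBr (inner H)).
rewrite !(linearZl_LR (inner H)) !(linearZr_LR (inner H)) /= conjK.
ring.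
Qed.

Section ShiftedPowers.
Variables (H : hilbertSpace conj) (A : set (H -> H)).
Hypothesis hA : jordan_operator_algebra A.
Implicit Types (a : H -> H) (c l : K) (n : nat).

(* [(a + l)^n a], written with Jordan operations only *)
Definition shifted_power a l n : H -> H :=
  iter n (fun w => 2^-1 *: anticommutator a w + l *: w) a.

Definition shifted_power_sum c a l n : H -> H :=
  \sum_(k < n) c ^+ k *: shifted_power a l k.

Lemma shifted_power_mem a l n : A a -> A (shifted_power a l n).
Proof.
move=> Aa; elim: n => //= n IHn; apply: (jordan_algebra_linear hA).
  exact: jordan_algebra_anticommutator.
exact: jordan_algebraZ.
Qed.

Lemma shifted_power_sum_mem c a l n : A a -> A (shifted_power_sum c a l n).
Proof.
move=> Aa; elim: n => [|n IHn]; rewrite /shifted_power_sum.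
  by rewrite big_ord0; exact: jordan_algebra0.
rewrite big_ord_recr /= addrC; apply: (jordan_algebra_linear hA) => //.
exact: shifted_power_mem.
Qed.

End ShiftedPowers.

Section OneUnitization.
Variables (H L : hilbertSpace conj) (A : set (H -> H)) (B : set (L -> L)).
Variables (e : L -> L) (i : (H -> H) -> L -> L).
Hypotheses (hA : jordan_operator_algebra A) (hu : unitization A B e i).
Implicit Types (a : H -> H) (c l : K) (n : nat).

Let hB : jordan_operator_algebra B. Proof. by case: hu. Qed.

Let hi : jordan_hom A B i. Proof. by case: hu => _ _ [[]]. Qed.

Lemma unitization_isometry a : A a -> opnorm (i a) = opnorm a.
Proof. by case: hu => _ _ [[_ +] _] _ _; apply. Qed.

Lemma unitization_bounded a : A a -> bounded_operator (i a).
Proof. exact: jordan_hom_bounded hi a. Qed.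

Lemma unitization_unit_bounded : bounded_operator e.
Proof. by case: hu => _ [[Be _] _] _ _ _; exact: jordan_algebra_bounded Be. Qed.

Let be := unitization_unit_bounded.

Lemma unitization_unit_contraction x : `|e x| <= `|x|.
Proof.
case: hu => _ [_ e1] _ _ _.
by have := opnorm_bound rhoP be x; rewrite e1 mul1r.
Qed.

Lemma unitization_unit_mul b : B b ->
  (forall x, e (b x) = b x) /\ (forall x, b (e x) = b x).
Proof.
case: hu => _ [eid _] _ _ _.
by apply: jordan_identity_mul => //; exact: unitization_unit_contraction.
Qed.

Lemma unitization_unitl a x : A a -> e (i a x) = i a x.
Proof. by move/(jordan_hom_mem hi)/unitization_unit_mul => [+ _]; apply. Qed.

Lemma unitization_unitr a x : A a -> i a (e x) = i a x.
Proof. by move/(jordan_hom_mem hi)/unitization_unit_mul => [_]; apply. Qed.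

Lemma unitization_unit_idem x : e (e x) = e x.
Proof.
by case: hu => _ [[Be _] _] _ _ _; have [+ _] := unitization_unit_mul Be; apply.
Qed.

Lemma unitization_extension_bounded a l : A a -> bounded_operator (i a + l *: e).
Proof.
move=> Aa; rewrite addrC; apply: bounded_operatorD => //.
exact: unitization_bounded.
Qed.

Let bT := unitization_extension_bounded.

Lemma unitization_extension_comm a l x : A a ->
  (i a + l *: e) (i a x) = i a ((i a + l *: e) x).
Proof.
move=> Aa; have bia := unitization_bounded Aa.
rewrite !fctE (boundedD _ _ bia) (boundedZ _ _ bia).
by rewrite unitization_unitl // unitization_unitr.
Qed.

Lemma shifted_power_image a l n x : A a ->
  i (shifted_power a l n) x = iter n (i a + l *: e) (i a x).
Proof.
move=> Aa.
have comm_iter m y :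
    i a (iter m (i a + l *: e) y) = iter m (i a + l *: e) (i a y).
  by elim: m => //= m <-; rewrite unitization_extension_comm.
elim: n x => // n IHn x; have Aw := shifted_power_mem hA l n Aa.
rewrite /= (jordan_homP hi) ?(jordan_homZ hA hi) //; last 2 first.
- exact: jordan_algebra_anticommutator.
- exact: jordan_algebraZ.
rewrite (jordan_hom_anticommutator hA hB hi) // /anticommutator -IHn !fctE.
rewrite (unitization_unitl _ Aw); congr (_ + _).
have -> : i (shifted_power a l n) (i a x) = i a (i (shifted_power a l n) x).
  by rewrite !IHn comm_iter.
by rewrite -mulr2n -[X in _ *: X]scaler_nat scalerA mulVf ?pnatr_eq0 // scale1r.
Qed.

Lemma shifted_power_sum_image c a l n x : A a ->
  i (shifted_power_sum c a l n) x =
  geometric_sum c (i a + l *: e) n (i a x).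
Proof.
move=> Aa; elim: n x => [|n IHn] x.
  by rewrite /shifted_power_sum /geometric_sum !big_ord0 (jordan_hom0 hA hi).
rewrite geometric_sumS -IHn /shifted_power_sum big_ord_recr /= addrC.
rewrite (jordan_homP hi) ?fctE ?shifted_power_image 1?addrC //.
  exact: shifted_power_mem.
exact: shifted_power_sum_mem.
Qed.

(* The quotient of [B] by the closed ideal [i @` A] is a contractive character:
   if [`|l|] exceeded the norm of [T = i a + l e], then
   [e = - l^-1 sum_k (l^-1 T)^k (i a)] would be a limit of elements of [i @` A]. *)
Lemma unitization_scalar_le a l : A a -> `|l| <= opnorm (i a + l *: e).
Proof.
move=> Aa; have : norm_closed (i @` A) by case: hu => _ _ [].
set T := i a + l *: e => clA; have bT' : bounded_operator T := bT l Aa.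
have N0 := opnorm_ge0 rhoP bT'.
apply/negP => /negP; rewrite -real_ltNge ?ger0_real // => Tl.
have l0 : l != 0 by rewrite -normr_gt0 (le_lt_trans N0).
have : ~ (i @` A) e by case: hu.
apply; apply: clA => // eps eps0.
have r1 : `|l|^-1 * opnorm T < 1 by rewrite mulrC ltr_pdivrMr ?mul1r ?normr_gt0.
have r0 : 0 <= `|l|^-1 * opnorm T by rewrite mulr_ge0 ?invr_ge0.
have [n rn] := geometric_small rhoP r0 r1 eps0.
have As := shifted_power_sum_mem hA l^-1 l n Aa.
exists (i (- l^-1 *: shifted_power_sum l^-1 a l n)).
  by eexists; last reflexivity; exact: jordan_algebraZ.
apply: le_lt_trans rn; apply: (opnorm_le rhoP) => [|x]; first exact: exprn_ge0.
have iax : i a x = - l *: (e x - l^-1 *: T (e x)).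
  rewrite /T !fctE unitization_unitr // unitization_unit_idem.
  rewrite (scalerDr l^-1) scalerA mulVf // scale1r [_ + e x]addrC opprD addrA.
  by rewrite subrr add0r scalerN scaleNr opprK scalerA divff // scale1r.
rewrite (jordan_homZ hA hi) // !fctE shifted_power_sum_image //.
rewrite -/T iax geometric_sumZ // scalerA mulrNN mulVf // scale1r.
rewrite geometric_sum_telescope // opprB addrC subrK normrZ normrX normfV.
rewrite exprMn -mulrA ler_wpM2l ?exprn_ge0 ?invr_ge0 //.
elim: n {As} => [|n IHn]; first by rewrite mul1r unitization_unit_contraction.
rewrite iterS exprS -mulrA; apply: le_trans (opnorm_bound rhoP bT' _) _.
by rewrite ler_wpM2l.
Qed.

Lemma shifted_power_opnorm a l n : A a ->
    (forall x, `|(i a + l *: e) x| <= `|x|) ->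
  opnorm (i (shifted_power a l n)) <= opnorm (i a).
Proof.
move=> Aa T1; have bia := unitization_bounded Aa.
apply: (opnorm_le rhoP) => [|x]; first exact: (opnorm_ge0 rhoP bia).
rewrite shifted_power_image //; apply: le_trans (iter_contraction _ _ T1) _.
exact: (opnorm_bound rhoP bia).
Qed.

(* For [mu = conj l] and [x = sum_(k < n) (mu T)^k e y], the operator on the left
   maps [y] to [(T - l) x], while [(1 - mu T) x = e y - (mu T)^n e y]. *)
Lemma shifted_power_sum_opnorm a l n : A a -> `|l| < 1 ->
    (forall x, `|(i a + l *: e) x| <= `|x|) ->
  opnorm (i (shifted_power_sum (conj l) a l n)) <= 1 + `|conj l| ^+ n.
Proof.
move=> Aa l1 T1; set mu := conj l; set T := i a + l *: e.
have bia := unitization_bounded Aa; have bT' : bounded_operator T := bT l Aa.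
apply: (opnorm_le rhoP) => [|y]; first by rewrite addr_ge0 // exprn_ge0.
rewrite shifted_power_sum_image // -(unitization_unitr y Aa) -/T.
have Tia z : T (i a z) = i a (T z) := unitization_extension_comm l z Aa.
have Te z : T (e z) = e (T z).
  rewrite /T !fctE (boundedD _ _ be) (boundedZ _ _ be).
  by rewrite unitization_unitl // unitization_unitr.
rewrite geometric_sum_comm //; set x := geometric_sum mu T n (e y).
have ex : e x = x.
  by rewrite /x geometric_sum_comm // unitization_unit_idem.
have -> : i a x = T x - l *: x by rewrite /T !fctE ex addrK.
have mobius : `|T x - l *: x| <= `|x - mu *: T x|.
  rewrite -(@ler_pXn2r _ 2) ?nnegrE // -subr_ge0 -mobius_identity mulr_ge0 //.
    by rewrite subr_ge0 exprn_ile1 // ltW.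
  by rewrite subr_ge0 lerXn2r ?nnegrE.
apply: le_trans mobius _.
have -> : x - mu *: T x = e y - mu ^+ n *: iter n T (e y).
  rewrite -geometric_sum_telescope // /x -(geometric_sum_comm _ _ _ bT') //.
  by rewrite geometric_sumB // geometric_sumZ.
apply: le_trans (ler_normB _ _) _; rewrite normrZ normrX mulrDl mul1r.
apply: lerD; first exact: unitization_unit_contraction.
rewrite ler_wpM2l ?exprn_ge0 //.
exact/(le_trans (iter_contraction _ _ T1))/unitization_unit_contraction.
Qed.

End OneUnitization.
Section TwoUnitizations.
Variables (H L1 L2 : hilbertSpace conj) (A : set (H -> H)).
Variables (B1 : set (L1 -> L1)) (e1 : L1 -> L1) (i1 : (H -> H) -> L1 -> L1).
Variables (B2 : set (L2 -> L2)) (e2 : L2 -> L2) (i2 : (H -> H) -> L2 -> L2).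
Hypotheses (hA : jordan_operator_algebra A).
Hypotheses (hu1 : unitization A B1 e1 i1) (hu2 : unitization A B2 e2 i2).
Implicit Types (a : H -> H) (l : K).

Lemma unitization_contraction_transfer a l : A a -> `|l| < 1 ->
    (forall x, `|(i1 a + l *: e1) x| <= `|x|) ->
  forall x, `|(i2 a + l *: e2) x| <= `|x|.
Proof.
move=> Aa l1 T1 x; set T : L2 -> L2 := i2 a + l *: e2; set mu := conj l.
have bT : bounded_operator T := unitization_extension_bounded hu2 l Aa.
have bia := unitization_bounded hu2 Aa.
have Te z : T z = T (e2 z).
  by rewrite /T !fctE (unitization_unitr hu2) // (unitization_unit_idem hu2).
have mu_l : `|mu| = `|l|.
  by apply/eqP; rewrite -(@eqrXn2 _ 2) // !mul_conj conjK mulrC.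
apply: le_trans (unitization_unit_contraction hu2 x); rewrite Te.
have : e2 (e2 x) = e2 x := unitization_unit_idem hu2 x.
move: (e2 x) => {}x ex.
have mobius : `|T x - l *: x| <= `|x - mu *: T x|.
  have -> : T x - l *: x = i2 a x by rewrite /T !fctE ex addrK.
  apply: (le_geometric_limit rhoP (normr_ge0 mu) (w := opnorm (i1 a) * `|x|)).
  - by rewrite mu_l.
  - by [].
  - by rewrite mulr_ge0 // (opnorm_ge0 rhoP (unitization_bounded hu1 Aa)).
  move=> n; pose p := shifted_power_sum mu a l n; pose w := shifted_power a l n.
  have Ap : A p := shifted_power_sum_mem hA mu l n Aa.
  have Aw : A w := shifted_power_mem hA l n Aa.
  have -> : i2 a x = i2 p (x - mu *: T x) + mu ^+ n *: i2 w x.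
    rewrite (shifted_power_sum_image hA hu2) // (shifted_power_image hA hu2) //.
    rewrite (boundedB _ _ bia) (boundedZ _ _ bia).
    rewrite -(unitization_extension_comm hu2) // -/T.
    by rewrite geometric_sum_telescope // subrK.
  apply: le_trans (ler_normD _ _) _; rewrite normrZ normrX; apply: lerD.
    apply: le_trans (opnorm_bound rhoP (unitization_bounded hu2 Ap) _) _.
    rewrite ler_wpM2r // (unitization_isometry hu2 Ap).
    by rewrite -(unitization_isometry hu1 Ap) (shifted_power_sum_opnorm hA hu1).
  rewrite ler_wpM2l ?exprn_ge0 //.
  apply: le_trans (opnorm_bound rhoP (unitization_bounded hu2 Aw) _) _.
  rewrite ler_wpM2r // (unitization_isometry hu2 Aw).
  by rewrite -(unitization_isometry hu1 Aw) (shifted_power_opnorm hA hu1).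
have := mobius_identity l x (T x).
rewrite -/mu => mobiusE.
have : 0 <= (1 - `|l| ^+ 2) * (`|x| ^+ 2 - `|T x| ^+ 2).
  by rewrite mobiusE subr_ge0 lerXn2r ?nnegrE.
rewrite pmulr_rge0 ?subr_gt0 ?exprn_ilt1 // subr_ge0.
by rewrite ler_pXn2r ?nnegrE.
Qed.

Lemma unitization_opnorm_le a l : A a ->
  opnorm (i2 a + l *: e2) <= opnorm (i1 a + l *: e1).
Proof.
move=> Aa; have bT1 := unitization_extension_bounded hu1 l Aa.
have N0 := opnorm_ge0 rhoP bT1; apply/ler_addgt0Pr => eps eps0.
set r := _ + eps; have r0 : 0 < r by rewrite ltr_wpDl.
have rV : `|r^-1| = r^-1 by rewrite ger0_norm // invr_ge0 ltW.
have scaleE (M : hilbertSpace conj) (B : set (M -> M))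
      (e : M -> M) (i : (H -> H) -> M -> M) x (hu : unitization A B e i) :
    (i (r^-1 *: a) + (r^-1 * l) *: e) x = r^-1 *: (i a + l *: e) x.
  case: hu => _ _ [[hi _] _] _ _.
  by rewrite (jordan_homZ hA hi) // !fctE scalerDr scalerA.
apply: (opnorm_le rhoP) => [|x]; first exact: ltW.
rewrite -ler_pdivrMl // -rV -normrZ -(scaleE _ _ _ _ _ hu2).
apply: unitization_contraction_transfer => [||{}x].
- exact: jordan_algebraZ.
- rewrite normrM rV mulrC ltr_pdivrMr // mul1r.
  by apply: le_lt_trans (unitization_scalar_le hA hu1 l Aa) _; rewrite ltrDl.
rewrite (scaleE _ _ _ _ _ hu1) normrZ rV ler_pdivrMl //.
apply: le_trans (opnorm_bound rhoP bT1 _) _.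
by rewrite ler_wpM2r // lerDl ltW.
Qed.

End TwoUnitizations.

Theorem unitization_unique (H L1 L2 : hilbertSpace conj) (A : set (H -> H))
    (B1 : set (L1 -> L1)) (e1 : L1 -> L1) (i1 : (H -> H) -> L1 -> L1)
    (B2 : set (L2 -> L2)) (e2 : L2 -> L2) (i2 : (H -> H) -> L2 -> L2) :
    jordan_operator_algebra A ->
    unitization A B1 e1 i1 -> unitization A B2 e2 i2 ->
  exists T : (L1 -> L1) -> L2 -> L2,
    [/\ isometric_jordan_iso B1 B2 T, T e1 = e2 & forall a, A a -> T (i1 a) = i2 a].
Proof.
move=> hA hu1 hu2.
have normE a l : A a -> opnorm (i2 a + l *: e2) = opnorm (i1 a + l *: e1).
  move=> Aa; apply/eqP; rewrite eq_le (unitization_opnorm_le hA hu1 hu2) //.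
  exact: (unitization_opnorm_le hA hu2 hu1).
have [_ _ [[hi1 _] _] _ B1E] := hu1; have [_ _ [[hi2 _] _] _ B2E] := hu2.
have B1P b : exists a l, B1 b -> A a /\ b = i1 a + l *: e1.
  have [Bb|nBb] := pselect (B1 b); last by exists 0, 0.
  by move: (Bb); rewrite {1}B1E => -[a Aa [l bE]]; exists a, l.
have [s /choice[t stP]] := choice B1P.
pose T b : L2 -> L2 := i2 (s b) + t b *: e2.
have A0 := jordan_algebra0 hA.
have TE a l : A a -> T (i1 a + l *: e1) = i2 a + l *: e2.
  move=> Aa; set b : L1 -> L1 := i1 a + l *: e1.
  have [|As bE] := stP b; first by rewrite B1E; exists a => //; exists l.
  apply/eqP; rewrite -subr_eq0 /T.
  have E (M : hilbertSpace conj) (B : set (M -> M))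
      (e : M -> M) (i : (H -> H) -> M -> M) (hi : jordan_hom A B i) :
      i (s b) + t b *: e - (i a + l *: e) = i (s b - a) + (t b - l) *: e.
    by rewrite (jordan_homB hi) // scalerBl opprD addrACA.
  rewrite (E _ _ _ _ hi2).
  have Asa : A (s b - a) by exact: jordan_algebraB.
  apply/eqP/(opnorm_eq0 rhoP); first exact: (unitization_extension_bounded hu2 _ Asa).
  rewrite normE // -(E _ _ _ _ hi1) -bE subrr.
  apply/eqP; rewrite eq_le (opnorm_ge0 rhoP (bounded_operator0 L1)) andbT.
  apply: (opnorm_le rhoP) => // x.
  by rewrite mul0r; change (`|0 : L1| <= 0); rewrite normr0.
exists T; split.
- split; first split; first split.
  + move=> b /stP[As bE]; rewrite B2E; exists (s b) => //; by exists (t b).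
  + move=> c b b' /stP[As ->] /stP[As' ->].
    have E (M : hilbertSpace conj) (B : set (M -> M))
      (e : M -> M) (i : (H -> H) -> M -> M) (hi : jordan_hom A B i) :
        c *: (i (s b) + t b *: e) + (i (s b') + t b' *: e) =
        i (c *: s b + s b') + (c * t b + t b') *: e.
      by rewrite (jordan_homP hi) // scalerDr scalerDl scalerA addrACA.
    rewrite !TE // (E _ _ _ _ hi2) (E _ _ _ _ hi1) TE //.
    exact: jordan_algebra_linear.
  + move=> b /stP[As ->].
    have E (M : hilbertSpace conj) (B : set (M -> M))
      (e : M -> M) (i : (H -> H) -> M -> M) (hu : unitization A B e i) :
        (i (s b) + t b *: e) \o (i (s b) + t b *: e) =
        i ((2 * t b) *: s b + (s b \o s b)) + (t b ^+ 2) *: e.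
      have [_ _ [[hi _] _] _ _] := hu.
      rewrite (jordan_homP hi) ?(jordan_hom_sqr hi) //; last exact: jordan_algebra_sqr.
      have bi := unitization_bounded hu As.
      have be := unitization_unit_bounded hu.
      apply/funext => x; rewrite !fctE !(boundedD _ _ bi) !(boundedD _ _ be).
      rewrite !(boundedZ _ _ bi) !(boundedZ _ _ be).
      rewrite (unitization_unit_idem hu).
      rewrite (unitization_unitl hu) // (unitization_unitr hu) //.
      rewrite scalerDr scalerA -expr2 !addrA; congr (_ + _).
      by rewrite -addrA -scalerDl addrC mulr_natl mulr2n.
    rewrite TE // (E _ _ _ _ hu2) (E _ _ _ _ hu1) TE //.
    by apply: jordan_algebra_linear => //; exact: jordan_algebra_sqr.
  + by move=> b /stP[As bE]; rewrite [in RHS]bE normE.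
  apply/seteqP; split=> [_ [b /stP[As bE] <-]|].
    by rewrite B2E; exists (s b) => //; exists (t b).
  rewrite B2E => _ [a Aa [l ->]]; exists (i1 a + l *: e1); last exact: TE.
  by rewrite B1E; exists a => //; exists l.
- have := TE 0 1 A0; rewrite (jordan_hom0 hA hi1) (jordan_hom0 hA hi2).
  by rewrite !add0r !scale1r.
- by move=> a Aa; have := TE a 0 Aa; rewrite !scale0r !addr0.
Qed.

End Unitization.

Section ScalarInstances.
Variable R : realType.

Lemma real_scalar_embedding : scalar_embedding (idfun : {rmorphism R -> R}).
Proof. by split=> // z _; exists z. Qed.

Lemma complex_scalar_embedding :
  scalar_embedding (real_complex R : {rmorphism R -> R[i]}).
Proof.
split=> [x y|[x y]]; first exact: lecR.
by rewrite lecE /= => /andP[/eqP -> _]; exists x.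
Qed.

End ScalarInstances.

Section ComplexifiedAlgebras.
Variables (R : realType) (H : realHilbertSpace R).
Local Notation Hc := (hilbert_complexification H).
Implicit Types (z w : Hc) (x y : H) (a b g h : H -> H) (A : set (H -> H)).

Local Notation rhoR := (real_scalar_embedding R).
Local Notation rhoC := (complex_scalar_embedding R).

Lemma complexification_normE z :
  `|z| = (Num.sqrt (`|z.1| ^+ 2 + `|z.2| ^+ 2))%:C%C.
Proof. by []. Qed.

Lemma complexification_norm1 z : (`|z.1|)%:C%C <= `|z|.
Proof.
rewrite complexification_normE lecR -[leLHS]ger0_norm // -sqrtr_sqr.
by rewrite ler_wsqrtr // lerDl sqr_ge0.
Qed.

Lemma complexification_norm2 z : (`|z.2|)%:C%C <= `|z|.
Proof.
rewrite complexification_normE lecR -[leLHS]ger0_norm // -sqrtr_sqr.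
by rewrite ler_wsqrtr // lerDr sqr_ge0.
Qed.

Lemma complexification_norm_le z : `|z| <= (`|z.1| + `|z.2|)%:C%C.
Proof.
rewrite complexification_normE lecR -[leRHS]ger0_norm ?addr_ge0 // -sqrtr_sqr.
by rewrite ler_wsqrtr // sqrrD -addrA [leRHS]addrCA lerDr mulrn_wge0 // mulr_ge0.
Qed.

Lemma complexification_norm_real x : `|((x, 0) : Hc)| = (`|x|)%:C%C.
Proof.
by rewrite complexification_normE /= normr0 expr0n addr0 sqrtr_sqr normr_id.
Qed.

Lemma complexification_addE z w : z + w = (z.1 + w.1, z.2 + w.2).
Proof. by []. Qed.

Lemma complexification_scaleE (c : R[i]) z :
  c *: z = (complex.Re c *: z.1 - complex.Im c *: z.2,
            complex.Im c *: z.1 + complex.Re c *: z.2).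
Proof. by []. Qed.

Lemma complex_operator_comb (c : R[i]) a b g h :
  c *: complex_operator a b + complex_operator g h =
  complex_operator (complex.Re c *: a - complex.Im c *: b + g)
                   (complex.Im c *: a + complex.Re c *: b + h) :> (Hc -> Hc).
Proof.
apply/funext => -[x y].
rewrite -[LHS]/(c *: complex_operator a b (x, y) + complex_operator g h (x, y)).
rewrite complexification_scaleE complexification_addE /complex_operator /= !fctE.
rewrite !scalerDr !scalerN !opprD.
by congr (_, _); rewrite [X in X + _ = _]addrACA [LHS]addrACA;
  rewrite [X in _ + (X + _) = _]addrC.
Qed.

Lemma complex_operatorB a b g h :
  (complex_operator a b : Hc -> Hc) - complex_operator g h =
  complex_operator (a - g) (b - h).
Proof.
apply/funext => -[x y].
rewrite -[LHS]/(a x - b y - (g x - h y), b x + a y - (h x + g y)).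
by rewrite /complex_operator /= !fctE !opprD; congr (_, _); exact: addrACA.
Qed.

Lemma complex_operator_comp a b g h : bounded_operator a -> bounded_operator b ->
  complex_operator a b \o complex_operator g h =
  complex_operator ((a \o g) - (b \o h)) ((b \o g) + (a \o h)) :> (Hc -> Hc).
Proof.
move=> ba bb; apply/funext => -[x y]; rewrite /complex_operator /= !fctE.
rewrite !(boundedB _ _ ba) !(boundedB _ _ bb) !(boundedD _ _ ba) !(boundedD _ _ bb).
by congr (_, _); rewrite ?opprD addrACA [X in _ + X = _]addrC -?addrA.
Qed.

Lemma complex_operator_bounded a b : bounded_operator a -> bounded_operator b ->
  bounded_operator (complex_operator a b : Hc -> Hc).
Proof.
move=> ba bb; split=> [c z w|].
  rewrite complexification_addE !complexification_scaleE complexification_addE.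
  rewrite /complex_operator /= -[- (complex.Im c *: z.2)]scaleNr.
  rewrite !(boundedD _ _ ba) !(boundedD _ _ bb) !(boundedZ _ _ ba) !(boundedZ _ _ bb).
  rewrite !scaleNr !scalerDr !scalerN !opprD.
  have swap u1 u2 u3 u4 : u1 + u2 + (u3 + u4) = u1 + u4 + (u3 + u2) :> H.
    by rewrite [u3 + u4]addrC addrACA [u2 + u3]addrC.
  congr (_, _); rewrite [LHS]addrACA; congr (_ + _).
    by rewrite [RHS]swap.
  by rewrite [RHS]addrC [RHS]swap.
have [M M0 aM] := bounded_nneg ba; have [N N0 bN] := bounded_nneg bb.
exists ((M + N) *+ 2)%:C%C => z; apply: le_trans (complexification_norm_le _) _.
have [r rE] : exists r : R, `|z| = r%:C%C by eexists; exact: complexification_normE.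
have := complexification_norm1 z; have := complexification_norm2 z.
rewrite rE -rmorphM !lecR /= => z2 z1.
apply: le_trans (_ : (M + N) * (`|z.1| + `|z.2|) <= _).
  apply: le_trans (lerD (ler_normB _ _) (ler_normD _ _)) _.
  have := aM z.1; have := aM z.2; have := bN z.1; have := bN z.2; lra.
by rewrite mulrnAl -mulrnAr ler_wpM2l ?addr_ge0 // mulr2n lerD.
Qed.

Lemma bounded_complex_operator (f : Hc -> Hc) : bounded_operator f ->
  exists a b, [/\ bounded_operator a, bounded_operator b & f = complex_operator a b].
Proof.
move=> bf; have [M M0 fM] := bounded_nneg bf.
have [m mE] := embedding_surj rhoC M0.
have fR x : `|f (x, 0)| <= (m * `|x|)%:C%C.
  by apply: le_trans (fM _) _; rewrite complexification_norm_real mE rmorphM.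
have fP c x y : f (c *: x + y, 0) = (c%:C)%C *: f (x, 0) + f (y, 0).
  rewrite -boundedP // complexification_scaleE complexification_addE /=.
  by rewrite !scale0r subr0 scaler0 !addr0.
exists (fun x => (f (x, 0)).1), (fun x => (f (x, 0)).2); split.
- split=> [c x y|]; first by rewrite fP complexification_addE /= scale0r subr0.
  exists m => x; rewrite -lecR; exact: le_trans (complexification_norm1 _) (fR x).
- split=> [c x y|]; first by rewrite fP complexification_addE /= scale0r add0r.
  exists m => x; rewrite -lecR; exact: le_trans (complexification_norm2 _) (fR x).
apply/funext => -[x y]; rewrite /complex_operator /=.
have -> : (x, y) = (0 +i* 1)%C *: ((y, 0) : Hc) + (x, 0).
  rewrite complexification_scaleE complexification_addE /=.
  by rewrite scale0r scaler0 subr0 add0r scale1r scaler0 !addr0.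
rewrite boundedP // complexification_scaleE complexification_addE /=.
by rewrite !scale0r !scale1r sub0r addr0; congr (_, _); exact: addrC.
Qed.

Lemma opnorm_complex_operator1 a b : bounded_operator a -> bounded_operator b ->
  (opnorm a)%:C%C <= opnorm (complex_operator a b : Hc -> Hc).
Proof.
move=> ba bb; have bab := complex_operator_bounded ba bb.
have N0 := opnorm_ge0 rhoC bab; have [m mE] := embedding_surj rhoC N0.
rewrite mE lecR; apply: (opnorm_le rhoR) => [|x].
  by rewrite -(embedding_ge0 rhoC) -mE.
have := opnorm_bound rhoC bab (x, 0); rewrite mE complexification_norm_real.
move/(le_trans (complexification_norm1 _)); rewrite -rmorphM lecR /=.
by rewrite (bounded0 bb) subr0.
Qed.

Lemma opnorm_complex_operator2 a b : bounded_operator a -> bounded_operator b ->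
  (opnorm b)%:C%C <= opnorm (complex_operator a b : Hc -> Hc).
Proof.
move=> ba bb; have bab := complex_operator_bounded ba bb.
have N0 := opnorm_ge0 rhoC bab; have [m mE] := embedding_surj rhoC N0.
rewrite mE lecR; apply: (opnorm_le rhoR) => [|x].
  by rewrite -(embedding_ge0 rhoC) -mE.
have := opnorm_bound rhoC bab (x, 0); rewrite mE complexification_norm_real.
move/(le_trans (complexification_norm2 _)); rewrite -rmorphM lecR /=.
by rewrite (bounded0 ba) addr0.
Qed.

Lemma complexified_subspace A :
  subspace_op A -> subspace_op (complexified_operators A).
Proof.
move=> [A0 Alin]; split=> [|c _ _ [a Aa [b Ab ->]] [g Ag [h Ah ->]]].
  exists 0 => //; exists 0 => //; apply/funext => -[x y].
  by rewrite /complex_operator /= subr0 addr0.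
have AZ d f : A f -> A (d *: f) by move=> Af; rewrite -[_ *: _]addr0; exact: Alin.
rewrite complex_operator_comb; eexists; last first.
  eexists; last reflexivity.
  by rewrite -addrA; apply: (Alin) => //; exact: Alin.
rewrite -addrA -scaleNr; apply: (Alin) => //; exact: Alin.
Qed.

Lemma complexified_norm_closed A : A `<=` (@bounded_operator R idfun H) ->
  subspace_op A -> norm_closed A -> norm_closed (complexified_operators A).
Proof.
move=> bA [_ Alin] clA f /bounded_complex_operator[a [b [ba bb ->]]] approx.
have bB g h : bounded_operator g -> A h -> bounded_operator (g - h).
  move=> bg /bA bh; rewrite addrC -scaleN1r; exact: bounded_operatorD.
exists a; last exists b => //; apply: clA => // eps eps0.
  have [|_ [g Ag [h Ah ->]]] := approx eps%:C%C; first by rewrite ltcR.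
  rewrite complex_operatorB => ltab; exists g => //.
  rewrite -ltcR; apply: le_lt_trans ltab.
  by apply: opnorm_complex_operator1; exact: bB.
have [|_ [g Ag [h Ah ->]]] := approx eps%:C%C; first by rewrite ltcR.
rewrite complex_operatorB => ltab; exists h => //.
rewrite -ltcR; apply: le_lt_trans ltab.
by apply: opnorm_complex_operator2; exact: bB.
Qed.

Lemma complex_operator_adjoint a b g h :
  is_adjoint a g -> is_adjoint b h ->
  is_adjoint (complex_operator a b : Hc -> Hc) (complex_operator g (- h)).
Proof.
move=> ag bh [x y] [x' y'].
rewrite -[LHS]/(complexification_inner _ _) -[RHS]/(complexification_inner _ _).
rewrite /complexification_inner /complex_operator /= !fctE.
have innerBl u v t : inner H (u - v) t = inner H u t - inner H v t.
  exact: (linearBl (inner H)).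
have innerDl u v t : inner H (u + v) t = inner H u t + inner H v t.
  exact: (linearDl (inner H)).
have innerDr u v t : inner H u (v + t) = inner H u v + inner H u t.
  exact: (linearDr (inner H)).
have innerNr u v : inner H u (- v) = - inner H u v.
  exact: (linearNr (inner H)).
rewrite !(innerBl, innerDl, innerDr, innerNr) !ag !bh.
by apply/eqP; rewrite eq_complex /=; apply/andP; split; apply/eqP; ring.
Qed.

Lemma complexified_Cstar_algebra A :
  Cstar_algebra A -> Cstar_algebra (complexified_operators A).
Proof.
move=> [bA sA clA compA adjA]; have [A0 Alin] := sA.
split.
- by move=> _ [a /bA ba [b /bA bb ->]]; exact: complex_operator_bounded.
- exact: complexified_subspace.
- exact: complexified_norm_closed.
- move=> _ _ [a Aa [b Ab ->]] [g Ag [h Ah ->]].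
  rewrite complex_operator_comp; [|exact: bA|exact: bA].
  eexists; last (eexists; last reflexivity).
    by rewrite addrC -scaleN1r; apply: Alin; exact: compA.
  by rewrite -[_ \o _]scale1r; apply: Alin; exact: compA.
move=> _ [a Aa [b Ab ->]].
have [g Ag ag] := adjA _ Aa; have [h Ah bh] := adjA _ Ab.
exists (complex_operator g (- h)); last exact: complex_operator_adjoint.
exists g => //; exists (- h) => //.
by rewrite -scaleN1r -[_ *: _]addr0; exact: Alin.
Qed.

Lemma complexified_jordan_algebra A :
  jordan_operator_algebra A -> jordan_operator_algebra (complexified_operators A).
Proof.
move=> hA; case: (hA) => C [hC AC sA clA _].
exists (complexified_operators C); split.
- exact: complexified_Cstar_algebra.
- by move=> _ [a Aa [b Ab ->]]; exists a; [|exists b => //]; exact: AC.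
- exact: complexified_subspace.
- by apply: complexified_norm_closed => // a Aa; exact: jordan_algebra_bounded Aa.
move=> _ [a Aa [b Ab ->]]; rewrite complex_operator_comp; last 2 first.
- exact: jordan_algebra_bounded Aa.
- exact: jordan_algebra_bounded Ab.
exists ((a \o a) - (b \o b)).
  by apply: (jordan_algebraB hA); exact: jordan_algebra_sqr.
exists ((b \o a) + (a \o b)) => //.
exact: (jordan_algebra_anticommutator hA).
Qed.

End ComplexifiedAlgebras.

Lemma jordan_algebra_image (K : numFieldType) (conj : K -> K)
    (H L : hilbertSpace conj) (A : set (H -> H)) (B : set (L -> L)) i :
    jordan_operator_algebra A -> jordan_operator_algebra B ->
    jordan_hom A B i -> norm_closed (i @` A) ->
  jordan_operator_algebra (i @` A).
Proof.
move=> hA [C [hC BC _ _ _]] hi clA; exists C; split=> //.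
- by move=> _ [a Aa <-]; apply/BC/(jordan_hom_mem hi).
- split; first by exists 0; [exact: jordan_algebra0|exact: (jordan_hom0 hA hi)].
  move=> c _ _ [a Aa <-] [b Ab <-]; exists (c *: a + b).
    exact: jordan_algebra_linear.
  exact: (jordan_homP hi).
move=> _ [a Aa <-]; exists (a \o a); first exact: jordan_algebra_sqr.
exact: (jordan_hom_sqr hi).
Qed.

Lemma complexified_unitization (R : realType) (H L : realHilbertSpace R)
    (A : set (H -> H)) (B : set (L -> L)) (i : (H -> H) -> L -> L) :
    jordan_operator_algebra A -> unitization A B idfun i ->
  jordan_operator_algebra (complexified_operators (i @` A)) /\
  unitization (complexified_operators (i @` A)) (complexified_operators B) idfun id.
Proof.
move=> hA hu; have [hB [[B1 _] norm1] [[hi _] clA] nA1 BE] := hu.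
have hiA := jordan_algebra_image hA hB hi clA.
have rhoR := real_scalar_embedding R; have rhoC := complex_scalar_embedding R.
have hAc := complexified_jordan_algebra hiA.
have hBc := complexified_jordan_algebra hB.
have sub : complexified_operators (i @` A) `<=` complexified_operators B.
  move=> _ [_ [a Aa <-] [_ [b Ab <-] ->]].
  by exists (i a); [|exists (i b) => //]; exact: (jordan_hom_mem hi).
have idE : idfun = complex_operator idfun 0 :>
    (hilbert_complexification L -> hilbert_complexification L).
  by apply/funext => -[x y]; rewrite /complex_operator /= subr0 add0r.
have B1c : complexified_operators B idfun.
  by exists idfun => //; exists 0; [exact: (jordan_algebra0 hB)|exact: idE].
have b1 : bounded_operator (idfun : L -> L) := jordan_algebra_bounded hB B1.
have b0 : bounded_operator (0 : L -> L) := bounded_operator0 L.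
split=> //; split=> //.
- split.
    split=> // b _; rewrite /jordan_product; apply/funext => z; rewrite !fctE /=.
    by rewrite -mulr2n -[X in _ *: X]scaler_nat scalerA mulVf ?scale1r // pnatr_eq0.
  apply/eqP; rewrite eq_le; apply/andP; split.
    by apply: (opnorm_le rhoC) => // z; rewrite mul1r.
  by rewrite [in leRHS]idE -(rmorph1 (real_complex R)) -norm1;
    exact: opnorm_complex_operator1.
- split; last by rewrite image_id; case: hAc => C [_ _ _ ? _].
  by split=> //; split=> // f Af; exact: sub.
- rewrite image_id => -[_ [a Aa <-] [_ [b Ab <-]]] abE; apply: nA1.
  exists a => //; apply/funext => x.
  have := congr1 (fun f : hilbert_complexification L -> _ => (f (x, 0)).1) abE.
  by rewrite /complex_operator /= (bounded0 (jordan_hom_bounded hB hi Ab)) subr0.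
apply/seteqP; split=> [_ [a' + [b' + ->]]|_ [f Af [c ->]]].
  rewrite {1 2}BE => -[a Aa [c ->]] [b Ab [d ->]].
  exists (complex_operator (i a) (i b)).
    by exists (i a); [exists a|exists (i b) => //; exists b].
  exists (c +i* d)%C; rewrite [RHS]addrC idE complex_operator_comb /=.
  congr complex_operator; apply/funext => x; rewrite !fctE.
    by rewrite scaler0 subr0 addrC.
  by rewrite scaler0 addr0 addrC.
rewrite addrC; apply: (jordan_algebra_linear hBc) => //; exact: sub.
Qed.

Theorem corollary3p4 (R : realType) (H : realHilbertSpace R)
    (A : set (H -> H)) (hA : jordan_operator_algebra A) :
  (forall (L1 L2 : realHilbertSpace R)
          (B1 : set (L1 -> L1)) (e1 : L1 -> L1) (i1 : (H -> H) -> L1 -> L1)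
          (B2 : set (L2 -> L2)) (e2 : L2 -> L2) (i2 : (H -> H) -> L2 -> L2),
      unitization A B1 e1 i1 -> unitization A B2 e2 i2 ->
      exists T : (L1 -> L1) -> L2 -> L2,
        [/\ isometric_jordan_iso B1 B2 T, T e1 = e2
          & forall a, A a -> T (i1 a) = i2 a])
  /\
  (forall (L : realHilbertSpace R) (A1 : set (L -> L))
          (i : (H -> H) -> L -> L),
      unitization A A1 idfun i ->
      let Ac := complexified_operators (i @` A) in
      let A1c := complexified_operators A1 in
      [/\ jordan_operator_algebra Ac, unitization Ac A1c idfun id
        & forall (M : complexHilbertSpace R) (D : set (M -> M)) (d : M -> M)
                 (k : (hilbert_complexification L -> hilbert_complexification L)
                      -> M -> M),
            unitization Ac D d k ->
            exists T : (hilbert_complexification L ->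
                        hilbert_complexification L) -> M -> M,
              [/\ isometric_jordan_iso A1c D T, T idfun = d
                & forall a, Ac a -> T a = k a]]).
Proof.
split=> [L1 L2 B1 e1 i1 B2 e2 i2|L A1 i hu Ac A1c].
  apply: (unitization_unique (real_scalar_embedding R)) => // z.
  by rewrite -normrX ger0_norm // sqr_ge0.
have [hAc hAc1] := complexified_unitization hA hu.
split=> // M D d k huD.
apply: (unitization_unique (complex_scalar_embedding R) _ _ hAc hAc1 huD).
  exact: conjCK.
exact: normCK.
Qed.
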